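(* Let $\{x^k\}$ be a sequence generated by the pdNCG method (described in the context), where the parameter $\eta$ of the CG termination criterion $\|H(x^k,y^k)d^k+\nabla f(x^k)\|\le \eta\|\nabla f(x^k)\|$ is a constant with $0\le\eta<1$. Then $\{x^k\}$ converges to $x^*$, the minimizer of $f(x)=\tau\psi_\mu(x)+\varphi(x)$ over $\mathbb{R}^m$.
   Context: Problem. Let $\tau>0$, $\mu>0$, and let $\varphi:\mathbb{R}^m\to\mathbb{R}$ be twice differentiable with $\lambda_m I\preceq\nabla^2\varphi(x)\preceq\lambda_1 I$ for all $x$, where $0<\lambda_m\le\lambda_1$, and $\|\nabla^2\varphi(y)-\nabla^2\varphi(x)\|\le L_\varphi\|y-x\|$ for all $x,y$, where $L_\varphi\ge0$. Here $\|\cdot\|$ is the Euclidean norm for vectors and the spectral norm for matrices. Let $\psi_\mu(x)=\sum_{i=1}^m\big((\mu^2+x_i^2)^{1/2}-\mu\big)$ and $f(x)=\tau\psi_\mu(x)+\varphi(x)$. Notation. $D=D(x)$ is the diagonal matrix with $[D]_{ii}=(\mu^2+x_i^2)^{-1/2}$. For $x,y\in\mathbb{R}^m$, $H(x,y)=\tau D(I-D\,\mathrm{diag}(x)\mathrm{diag}(y))+\nabla^2\varphi(x)$, where $D=D(x)$. At iterate $(x^k,y^k)$ the local norm is $\|v\|_{x^k}=\sqrt{v^\intercal H(x^k,y^k)v}$. Algorithm pdNCG. Constants: $0<c_2<1/2$, $0<c_3<1$. Start from $x^0\in\mathbb{R}^m$ and $y^0\in\mathbb{R}^m$ with $\|y^0\|_\infty\le1$.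 For $k=0,1,2,\dots$: (i) Compute $d^k$ by applying the conjugate gradients (CG) method, in exact arithmetic and started from the zero vector, to $H(x^k,y^k)d=-\nabla f(x^k)$, stopping when the CG iterate $d$ satisfies $\|H(x^k,y^k)d+\nabla f(x^k)\|\le\eta\|\nabla f(x^k)\|$. (ii) With $D=D(x^k)$, set $\Delta y^k=D(I-D\,\mathrm{diag}(x^k)\mathrm{diag}(y^k))d^k-(y^k-Dx^k)$. (iii) Set $\tilde y^{k+1}=y^k+\Delta y^k$ and let $y^{k+1}$ be the orthogonal projection of $\tilde y^{k+1}$ onto $\{y:\|y\|_\infty\le1\}$. (iv) Find the least integer $j\ge0$ with $f(x^k+c_3^jd^k)\le f(x^k)-c_2c_3^j\|d^k\|_{x^k}^2$ and set $\alpha=c_3^j$. (v) Set $x^{k+1}=x^k+\alpha d^k$. The sequences are regarded as infinite (no stopping test). *)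

(* Defs.v *)
(* Vectors of R^m are column vectors. *)
From HB Require Import structures.
From mathcomp Require Import all_boot all_order all_algebra.
From mathcomp Require Import all_classical all_reals all_analysis.

Set Implicit Arguments.
Unset Strict Implicit.
Unset Printing Implicit Defensive.

Import Order.TTheory GRing.Theory Num.Theory.
Import numFieldNormedType.Exports.

Local Open Scope classical_set_scope.
Local Open Scope ring_scope.

Definition dot (R : realType) (m : nat) (u v : 'cV[R]_m) : R :=
  (u^T *m v) 0 0.

(* Euclidean norm; the norm [`|v|] of the library on matrices is the
   max-norm, i.e. the l^oo norm of a vector. *)
Definition enorm (R : realType) (m : nat) (v : 'cV[R]_m) : R :=
  Num.sqrt (dot v v).

(* Operator norm induced by the Euclidean norm. *)
Definition spectral_norm (R : realType) (m : nat) (A : 'M[R]_m) : R :=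
  sup [set enorm (A *m v) | v in [set v : 'cV[R]_m | enorm v <= 1]].

(* As usual for the Loewner order, positive semidefiniteness includes
   symmetry. *)
Definition psdmx (R : realType) (m : nat) (A : 'M[R]_m) : Prop :=
  A^T = A /\ forall v : 'cV[R]_m, 0 <= dot v (A *m v).

Definition loewner_le (R : realType) (m : nat) (A B : 'M[R]_m) : Prop :=
  psdmx (B - A).

Definition grad (R : realType) (m : nat) (f : 'cV[R]_m -> R)
    (x : 'cV[R]_m) : 'cV[R]_m :=
  \col_i 'D_(delta_mx i 0) f x.

(* Jacobian matrix of the gradient. *)
Definition hess (R : realType) (m : nat) (f : 'cV[R]_m -> R)
    (x : 'cV[R]_m) : 'M[R]_m :=
  \matrix_(i, j) ('D_(delta_mx j 0) (grad f) x) i 0.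

Definition twice_differentiable (R : realType) (m : nat)
    (f : 'cV[R]_m -> R) : Prop :=
  (forall x, differentiable f x) /\ (forall x, differentiable (grad f) x).

Definition minimizer (R : realType) (m : nat) (f : 'cV[R]_m -> R)
    (x : 'cV[R]_m) : Prop :=
  forall z, f x <= f z.

Definition orth_proj (R : realType) (m : nat) (C : set 'cV[R]_m)
    (z p : 'cV[R]_m) : Prop :=
  C p /\ forall q, C q -> enorm (z - p) <= enorm (z - q).

Definition least (P : nat -> Prop) (j : nat) : Prop :=
  P j /\ forall i, P i -> (j <= i)%N.

(* Conjugate gradients for [A d = b] from [d = 0]: the state is
   (iterate, residual [b - A d], search direction). Once the residual
   vanishes the state no longer changes, since [0 / 0 = 0]. *)
Definition cg_next (R : realType) (m : nat) (A : 'M[R]_m)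
    (s : 'cV[R]_m * 'cV[R]_m * 'cV[R]_m) : 'cV[R]_m * 'cV[R]_m * 'cV[R]_m :=
  let: (d, r, p) := s in
  let a := dot r r / dot p (A *m p) in
  let r' := r - a *: (A *m p) in
  let b := dot r' r' / dot r r in
  (d + a *: p, r', r' + b *: p).

Definition cg_iterate (R : realType) (m : nat) (A : 'M[R]_m)
    (b : 'cV[R]_m) (i : nat) : 'cV[R]_m :=
  (iter i (cg_next A) (0, b, b)).1.1.

Definition psi (R : realType) (m : nat) (mu : R) (x : 'cV[R]_m) : R :=
  \sum_(i < m) (Num.sqrt (mu ^+ 2 + x i 0 ^+ 2) - mu).

Definition objective (R : realType) (m : nat) (tau mu : R)
    (phi : 'cV[R]_m -> R) (x : 'cV[R]_m) : R :=
  tau * psi mu x + phi x.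

Definition Dmx (R : realType) (m : nat) (mu : R) (x : 'cV[R]_m) : 'M[R]_m :=
  diag_mx (\row_i (Num.sqrt (mu ^+ 2 + x i 0 ^+ 2))^-1).

(* D (I - D diag(x) diag(y)), where D = D(x). *)
Definition Bmx (R : realType) (m : nat) (mu : R) (x y : 'cV[R]_m) : 'M[R]_m :=
  Dmx mu x *m (1%:M - Dmx mu x *m diag_mx x^T *m diag_mx y^T).

Definition Hmx (R : realType) (m : nat) (tau mu : R) (phi : 'cV[R]_m -> R)
    (x y : 'cV[R]_m) : 'M[R]_m :=
  tau *: Bmx mu x y + hess phi x.

Definition local_norm (R : realType) (m : nat) (H : 'M[R]_m)
    (v : 'cV[R]_m) : R :=
  Num.sqrt (dot v (H *m v)).

Definition dual_step (R : realType) (m : nat) (mu : R)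
    (x y d : 'cV[R]_m) : 'cV[R]_m :=
  Bmx mu x y *m d - (y - Dmx mu x *m x).

(* [d] is the first CG iterate that satisfies the termination criterion. *)
Definition cg_direction (R : realType) (m : nat) (eta : R) (H : 'M[R]_m)
    (g d : 'cV[R]_m) : Prop :=
  exists2 i : nat,
    least (fun l => enorm (H *m cg_iterate H (- g) l + g) <= eta * enorm g) i &
    d = cg_iterate H (- g) i.

Definition backtracking (R : realType) (m : nat) (c2 c3 : R)
    (f : 'cV[R]_m -> R) (H : 'M[R]_m) (x d : 'cV[R]_m) (j : nat) : Prop :=
  least (fun l => f (x + c3 ^+ l *: d)
                  <= f x - c2 * c3 ^+ l * local_norm H d ^+ 2) j.

(* One iteration (x, y) -> (x', y'), with direction [d] and step size
   [c3 ^+ j]. *)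
Record pdNCG_step (R : realType) (m : nat) (tau mu eta c2 c3 : R)
    (phi : 'cV[R]_m -> R) (x y d : 'cV[R]_m) (j : nat)
    (x' y' : 'cV[R]_m) : Prop := PdNCGStep {
  pdNCG_direction :
    cg_direction eta (Hmx tau mu phi x y) (grad (objective tau mu phi) x) d ;
  pdNCG_dual :
    orth_proj [set z : 'cV[R]_m | `|z| <= 1] (y + dual_step mu x y d) y' ;
  pdNCG_linesearch :
    backtracking c2 c3 (objective tau mu phi) (Hmx tau mu phi x y) x d j ;
  pdNCG_primal : x' = x + c3 ^+ j *: d
}.

Definition pdNCG (R : realType) (m : nat) (tau mu eta c2 c3 : R)
    (phi : 'cV[R]_m -> R) (x y : nat -> 'cV[R]_m) : Prop :=
  `|y 0%N| <= 1 /\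
  forall k, exists d j,
    pdNCG_step tau mu eta c2 c3 phi (x k) (y k) d j (x k.+1) (y k.+1).

(* Main.v *)
(* Since |y_i| <= 1, the matrix H = H(x, y) is symmetric with
   lamm I <= H <= (2 tau / mu + lam1) I. Every CG iterate d is orthogonal to its
   residual, so g.d = - d.Hd where g is the gradient of f; as g is Lipschitz,
   backtracking accepts a step length bounded away from 0, and the stopping
   test gives d.Hd >= const * |g|^2. Hence f (x k) decreases by at least
   c * |g (x k)|^2 with c > 0 fixed. Strong convexity bounds f from below, so
   g (x k) tends to 0, and then lamm * |x k - x l| <= |g (x k)| + |g (x l)|
   makes (x k) a Cauchy sequence. Its limit minimizes f, by the quadratic
   lower and upper bounds of f at x k. In particular, the existence of a
   minimizer comes from the iteration itself. *)
Require Import Defs.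
From HB Require Import structures.
From mathcomp Require Import all_boot all_order all_algebra.
From mathcomp Require Import all_classical all_reals all_analysis.
From mathcomp Require Import ring lra.
Import Order.TTheory GRing.Theory Num.Theory.
Import numFieldNormedType.Exports.
Local Open Scope classical_set_scope.
Local Open Scope ring_scope.

Set Implicit Arguments.
Unset Strict Implicit.

(** * Euclidean inner product and norm *)

Lemma dotE (R : realType) (m : nat) (u v : 'cV[R]_m) :
  dot u v = \sum_i u i 0 * v i 0.
Proof. by rewrite /dot mxE; apply: eq_bigr => i _; rewrite mxE. Qed.

Lemma dotC (R : realType) (m : nat) (u v : 'cV[R]_m) : dot u v = dot v u.
Proof. by rewrite !dotE; apply: eq_bigr => i _; rewrite mulrC. Qed.

Lemma dotDr (R : realType) (m : nat) (u v w : 'cV[R]_m) :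
  dot u (v + w) = dot u v + dot u w.
Proof. by rewrite /dot mulmxDr mxE. Qed.

Lemma dotNr (R : realType) (m : nat) (u v : 'cV[R]_m) :
  dot u (- v) = - dot u v.
Proof. by rewrite /dot mulmxN mxE. Qed.

Lemma dotZr (R : realType) (m : nat) (u v : 'cV[R]_m) (a : R) :
  dot u (a *: v) = a * dot u v.
Proof. by rewrite /dot -scalemxAr mxE. Qed.

Lemma dotDl (R : realType) (m : nat) (u v w : 'cV[R]_m) :
  dot (u + v) w = dot u w + dot v w.
Proof. by rewrite dotC dotDr !(dotC w). Qed.

Lemma dotNl (R : realType) (m : nat) (u v : 'cV[R]_m) :
  dot (- u) v = - dot u v.
Proof. by rewrite dotC dotNr dotC. Qed.

Lemma dotZl (R : realType) (m : nat) (u v : 'cV[R]_m) (a : R) :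
  dot (a *: u) v = a * dot u v.
Proof. by rewrite dotC dotZr dotC. Qed.

Definition dotlin := (dotDr, dotNr, dotZr, dotDl, dotNl, dotZl).

Lemma dot0r (R : realType) (m : nat) (u : 'cV[R]_m) : dot u 0 = 0.
Proof. by rewrite /dot mulmx0 mxE. Qed.

Lemma dot0l (R : realType) (m : nat) (u : 'cV[R]_m) : dot 0 u = 0.
Proof. by rewrite dotC dot0r. Qed.

Lemma dot_trmx (R : realType) (m : nat) (A : 'M[R]_m) (u v : 'cV[R]_m) :
  dot u (A *m v) = dot (A^T *m u) v.
Proof. by rewrite /dot trmx_mul trmxK mulmxA. Qed.

Lemma dotvv_ge0 (R : realType) (m : nat) (v : 'cV[R]_m) : 0 <= dot v v.
Proof. by rewrite dotE; apply: sumr_ge0 => i _; rewrite -expr2 sqr_ge0. Qed.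

Lemma dotvv_eq0 (R : realType) (m : nat) (v : 'cV[R]_m) :
  (dot v v == 0) = (v == 0).
Proof.
apply/eqP/eqP => [|->]; last exact: dot0r.
rewrite dotE => v0; apply/matrixP => i j; rewrite ord1 mxE.
have v_ge0 (k : 'I_m) : true -> 0 <= v k 0 * v k 0.
  by rewrite -expr2 sqr_ge0.
by have /eqP := psumr_eq0P v_ge0 v0 (erefl true : xpredT i);
  rewrite mulf_eq0 orbb => /eqP.
Qed.

Lemma enorm_sqr (R : realType) (m : nat) (v : 'cV[R]_m) :
  enorm v ^+ 2 = dot v v.
Proof. by rewrite sqr_sqrtr // dotvv_ge0. Qed.

Lemma enorm_ge0 (R : realType) (m : nat) (v : 'cV[R]_m) : 0 <= enorm v.
Proof. exact: sqrtr_ge0. Qed.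

(** Cauchy-Schwarz: for nonzero [v], the squared length of [(v.v) u - (u.v) v] is [v.v] times the
    Gram determinant of [u] and [v]. *)
Lemma dot_le_enorm (R : realType) (m : nat) (u v : 'cV[R]_m) :
  dot u v <= enorm u * enorm v.
Proof.
have [v0|v0] := eqVneq v 0; first by rewrite v0 dot0r /enorm dot0r sqrtr0 mulr0.
have vv_gt0 : 0 < dot v v by rewrite lt_def dotvv_eq0 v0 dotvv_ge0.
have := dotvv_ge0 (dot v v *: u - dot u v *: v).
rewrite !dotlin (dotC v u) => cs.
have {}cs : 0 <= dot v v * (dot u u * dot v v - dot u v ^+ 2) by nra.
rewrite pmulr_rge0 // subr_ge0 in cs.
have [uv|uv] := leP (dot u v) 0.
  by apply: le_trans uv _; rewrite mulr_ge0 ?enorm_ge0.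
rewrite -(@ler_pXn2r _ 2) ?nnegrE ?mulr_ge0 ?enorm_ge0 ?(ltW uv) //.
by rewrite exprMn !enorm_sqr.
Qed.

Lemma abs_coord_le_enorm (R : realType) (m : nat) (v : 'cV[R]_m) (i : 'I_m) :
  `|v i 0| <= enorm v.
Proof.
rewrite -sqrtr_sqr ler_sqrt ?dotvv_ge0 // dotE (bigD1 i) //= expr2 lerDl.
by apply: sumr_ge0 => j _; rewrite -expr2 sqr_ge0.
Qed.

(** Estimates are made in the Euclidean norm, limits are taken in the max-norm; this inequality
    passes from one to the other. *)
Lemma mx_norm_le_enorm (R : realType) (m : nat) (v : 'cV[R]_m) :
  `|v| <= enorm v.
Proof.
rewrite -[leLHS]/(mx_norm v) mx_normrE; apply/bigmax_leP.
split=> [|[i j] _]; first exact: enorm_ge0.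
rewrite /=.
by rewrite ord1 abs_coord_le_enorm.
Qed.

(** * Conjugate gradients: recurrences and orthogonality *)

Definition cg_residual (R : realType) (m : nat) (A : 'M[R]_m) (b : 'cV[R]_m)
  (n : nat) : 'cV[R]_m := (iter n (cg_next A) (0, b, b)).1.2.

Definition cg_search (R : realType) (m : nat) (A : 'M[R]_m) (b : 'cV[R]_m)
  (n : nat) : 'cV[R]_m := (iter n (cg_next A) (0, b, b)).2.

Definition cg_alpha (R : realType) (m : nat) (A : 'M[R]_m) (b : 'cV[R]_m)
    (n : nat) : R :=
  let r := cg_residual A b n in
  let p := cg_search A b n in dot r r / dot p (A *m p).

Definition cg_beta (R : realType) (m : nat) (A : 'M[R]_m) (b : 'cV[R]_m)
    (n : nat) : R :=
  let r := cg_residual A b n in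
  let r' := cg_residual A b n.+1 in dot r' r' / dot r r.

Lemma cg_iterateS (R : realType) (m : nat) (A : 'M[R]_m) (b : 'cV[R]_m) n :
  cg_iterate A b n.+1 =
  cg_iterate A b n + cg_alpha A b n *: cg_search A b n.
Proof.
rewrite /cg_iterate /cg_alpha /cg_residual /cg_search iterS.
by case: (iter _ _ _) => [[]].
Qed.

Lemma cg_residualS (R : realType) (m : nat) (A : 'M[R]_m) (b : 'cV[R]_m) n :
  cg_residual A b n.+1 =
  cg_residual A b n - cg_alpha A b n *: (A *m cg_search A b n).
Proof.
rewrite /cg_alpha /cg_residual /cg_search iterS.
by case: (iter _ _ _) => [[]].
Qed.

Lemma cg_searchS (R : realType) (m : nat) (A : 'M[R]_m) (b : 'cV[R]_m) n :
  cg_search A b n.+1 =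
  cg_residual A b n.+1 + cg_beta A b n *: cg_search A b n.
Proof.
rewrite /cg_beta /cg_residual /cg_search !iterS.
by case: (iter _ _ _) => [[]].
Qed.

Lemma cg_residualE (R : realType) (m : nat) (A : 'M[R]_m) (b : 'cV[R]_m) n :
  cg_residual A b n = b - A *m cg_iterate A b n.
Proof.
elim: n => [|n IHn]; first by rewrite /cg_iterate /= mulmx0 subr0.
by rewrite cg_residualS cg_iterateS IHn mulmxDr -scalemxAr opprD addrA.
Qed.

(** The step size makes each new residual orthogonal to the search direction just used, so only the
    residual part of the next direction contributes. If [p.Ap = 0], definiteness gives [p = 0] and
    the same term vanishes. *)
Lemma cg_search_dot_residual (R : realType) (m : nat) (A : 'M[R]_m)
    (b : 'cV[R]_m) n :
  (forall v, dot v (A *m v) = 0 -> v = 0) ->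
  dot (cg_search A b n) (cg_residual A b n) =
  dot (cg_residual A b n) (cg_residual A b n).
Proof.
move=> A_def; elim: n => [//|n IHn].
rewrite cg_searchS dotDl dotZl {3}cg_residualS dotDr dotNr dotZr IHn /cg_alpha.
set p := cg_search A b n.
have [pAp|pAp] := eqVneq (dot p (A *m p)) 0; last first.
  by rewrite divfK // subrr mulr0 addr0.
by rewrite pAp mulr0 subr0 -IHn -/p (A_def _ pAp) dot0l mulr0 addr0.
Qed.

Lemma cg_search_eq0 (R : realType) (m : nat) (A : 'M[R]_m) (b : 'cV[R]_m) n :
  (forall v, dot v (A *m v) = 0 -> v = 0) ->
  (cg_search A b n == 0) = (cg_residual A b n == 0).
Proof.
move=> A_def; apply/eqP/eqP => [p0|].
  by apply/eqP; rewrite -dotvv_eq0 -cg_search_dot_residual // p0 dot0l.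
(* A zero residual makes [cg_beta] zero through its numerator, so the previous direction drops
   out. *)
case: n => [//|n] r0; rewrite cg_searchS /cg_beta r0 dot0r mul0r scale0r.
exact: addr0.
Qed.

(* The j-th search direction is a combination of the residuals up to j. *)
Lemma cg_search_residual (R : realType) (m : nat) (A : 'M[R]_m)
    (b v : 'cV[R]_m) n :
  (forall j, (j < n)%N -> dot (cg_residual A b j) v = 0) ->
  forall j, (j < n)%N -> dot (cg_search A b j) v = 0.
Proof.
move=> rv; elim=> [|j IHj] jn; first exact: (rv 0%N jn).
by rewrite cg_searchS !dotlin rv // IHj ?mulr0 ?addr0 // ltnW.
Qed.

(** The residual and the search direction at [n] differ by a multiple of the direction at [n - 1];
    at [n = 0] they coincide. *)
Lemma cg_residual_search (R : realType) (m : nat) (A : 'M[R]_m)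
    (b v : 'cV[R]_m) n :
  (forall j, (j < n)%N -> dot (cg_search A b j) v = 0) ->
  dot (cg_residual A b n) v = dot (cg_search A b n) v.
Proof.
case: n => [//|n] pv.
by rewrite cg_searchS !dotlin pv // mulr0 addr0.
Qed.

(* A zero residual makes the search direction vanish too, so the induction also
   covers the steps after termination, where the step size is 0 / 0 = 0. *)
Lemma cg_orthogonality (R : realType) (m : nat) (A : 'M[R]_m) (b : 'cV[R]_m) :
  A^T = A -> (forall v, dot v (A *m v) = 0 -> v = 0) ->
  forall n,
    (forall j, (j < n)%N ->
       dot (cg_residual A b j) (cg_residual A b n) = 0) /\
    (forall j, (j < n)%N ->
       dot (cg_search A b j) (A *m cg_search A b n) = 0).
Proof.
move=> A_sym A_def.
set r := cg_residual A b; set p := cg_search A b.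
set a := cg_alpha A b.
elim=> [//|n [r_orth p_conj]].
have rp j : (j <= n)%N ->
    dot (r j) (A *m p n) = if j == n then dot (p n) (A *m p n) else 0.
  rewrite leq_eqVlt => /predU1P[->|jn].
    by rewrite eqxx; apply: cg_residual_search.
  rewrite (ltn_eqF jn) -(p_conj _ jn); apply: cg_residual_search => i ij.
  exact/p_conj/(ltn_trans ij).
have pAp_neq0 j : r j != 0 -> dot (p j) (A *m p j) != 0.
  rewrite -cg_search_eq0 // -/p; apply: contra_neq; exact: A_def.
have r_orthS j : (j < n.+1)%N -> dot (r j) (r n.+1) = 0.
  rewrite ltnS => jn; rewrite /r cg_residualS -/r -/p -/a !dotlin rp //.
  case: eqVneq => [->|j_neq].
    rewrite /a /cg_alpha -/r -/p.
    have [->|rn] := eqVneq (r n) 0; first by rewrite dot0l !mul0r subrr.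
    by rewrite divfK ?pAp_neq0 // subrr.
  by rewrite mulr0 subr0 r_orth // ltn_neqAle j_neq.
split=> // j; rewrite ltnS => jn.
have [rj0|rj] := eqVneq (r j) 0.
  have /eqP-> : p j == 0 by rewrite cg_search_eq0 // -/r rj0.
  exact: dot0l.
have rr_neq0 : dot (r j) (r j) != 0 by rewrite dotvv_eq0.
have aj : a j != 0 by rewrite mulf_neq0 ?invr_neq0 ?pAp_neq0.
(* After multiplication by [a j], the residual difference [r j - r j.+1] replaces
   [a j *: (A *m p j)], so conjugacy reduces to orthogonality of residuals. For [j = n] the two
   terms left over cancel by the choice of [cg_beta]. *)
apply: (mulfI aj); rewrite mulr0 /p cg_searchS -/p mulmxDr -scalemxAr dotDr -/r.
rewrite dotZr mulrDr dot_trmx A_sym -[X in X + _]dotZl.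
have -> : a j *: (A *m p j) = r j - r j.+1.
  by rewrite /r cg_residualS -/r opprB addrC subrK.
rewrite !dotlin r_orthS ?ltnS //.
move: jn; rewrite leq_eqVlt => /predU1P[jn|jn].
  rewrite -jn /cg_beta /a /cg_alpha -/r -/p.
  by field; rewrite rr_neq0 pAp_neq0.
by rewrite r_orthS ?ltnS // p_conj // !mulr0 subrr addr0.
Qed.

(** The n-th iterate is a combination of the first n search directions, and these are all orthogonal
    to the n-th residual. *)
Lemma cg_galerkin (R : realType) (m : nat) (A : 'M[R]_m) (b : 'cV[R]_m) n :
  A^T = A -> (forall v, dot v (A *m v) = 0 -> v = 0) ->
  dot (cg_iterate A b n) (b - A *m cg_iterate A b n) = 0.
Proof.
move=> A_sym A_def; rewrite -cg_residualE.
have [r_orth _] := cg_orthogonality b A_sym A_def n.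
have := cg_search_residual r_orth.
(* The residual is frozen as a fixed vector [v], so that the induction on [n] moves only the
   iterate. *)
move: (cg_residual A b n) => v {r_orth}.
elim: n => [|n IHn] pv; first by rewrite /cg_iterate dot0l.
rewrite cg_iterateS !dotlin pv // mulr0 addr0 IHn // => j jn.
exact/pv/ltnW.
Qed.

(** * Derivatives along lines and second-order Taylor bounds *)

Lemma line_quotientE (R : realType) (V W : normedModType R) (f : V -> W)
    (x v : V) (t : R) :
  (fun h : R => h^-1 *: (((fun s : R => f (x + s *: v)) \o shift t) (h *: 1)
                         - f (x + t *: v))) =
  (fun h : R => h^-1 *: ((f \o shift (x + t *: v)) (h *: v)
                         - f (x + t *: v))).
Proof.
apply/funext => h /=; rewrite [h *: 1]mulr1.
by rewrite scalerDl addrCA.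
Qed.

Lemma is_derive_line (R : realType) (V W : normedModType R) (f : V -> W)
    (x v : V) (t : R) :
  differentiable f (x + t *: v) ->
  is_derive t 1 (fun s : R => f (x + s *: v)) ('D_v f (x + t *: v)).
Proof.
move=> /(@diff_derivable _ _ _ _ _ v) df.
by split; rewrite /derivable /derive /= line_quotientE.
Qed.

Lemma col_sum_delta (R : realType) (m : nat) (v : 'cV[R]_m) :
  v = \sum_i v i 0 *: delta_mx i 0.
Proof.
rewrite {1}[v]matrix_sum_delta; apply: eq_bigr => i _.
by rewrite big_ord1.
Qed.

(** [grad] consists of partial derivatives; linearity of the differential extends them to every
    direction. *)
Lemma derive_dot_grad (R : realType) (m : nat) (f : 'cV[R]_m -> R)
    (x v : 'cV[R]_m) :
  differentiable f x -> 'D_v f x = dot (grad f x) v.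
Proof.
move=> df; rewrite deriveE // {1}[v]col_sum_delta linear_sum dotE.
by apply: eq_bigr => i _; rewrite linearZ /= mxE deriveE // mulrC.
Qed.

Lemma derive_grad_hess (R : realType) (m : nat) (f : 'cV[R]_m -> R)
    (x v : 'cV[R]_m) :
  differentiable (grad f) x -> 'D_v (grad f) x = hess f x *m v.
Proof.
move=> df; rewrite deriveE // {1}[v]col_sum_delta linear_sum.
apply/matrixP => i j; rewrite ord1 summxE mxE; apply: eq_bigr => k _.
by rewrite linearZ /= !mxE deriveE // mulrC.
Qed.

Lemma is_derive_dotl (R : realType) (m : nat) (g : R -> 'cV[R]_m)
    (dg v : 'cV[R]_m) (t : R) :
  is_derive t 1 g dg -> is_derive t 1 (fun s => dot (g s) v) (dot dg v).
Proof.
move=> [dg_t dgE].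
have -> : (fun s => dot (g s) v) = \sum_i (fun s => v i 0 *: g s i 0).
  apply/funext => s; rewrite fct_sumE dotE.
  by apply: eq_bigr => i _; exact: mulrC.
have -> : dot dg v = \sum_i v i 0 *: dg i 0.
  by rewrite dotE; apply: eq_bigr => i _; exact: mulrC.
apply: is_derive_sum => i; apply: is_deriveZ.
have gi : derivable (fun s => g s i 0) t 1 by move/derivable_mxP: dg_t; exact.
by split=> //; rewrite -dgE derive_mx // mxE.
Qed.

Lemma line_derive1 (R : realType) (m : nat) (phi : 'cV[R]_m -> R) :
  twice_differentiable phi -> forall (x v : 'cV[R]_m) (t : R),
  is_derive t 1 (fun s : R => phi (x + s *: v))
    (dot (grad phi (x + t *: v)) v).
Proof.
by move=> [phi_d _] x v t; rewrite -derive_dot_grad //; exact: is_derive_line.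
Qed.

Lemma line_derive2 (R : realType) (m : nat) (phi : 'cV[R]_m -> R) :
  twice_differentiable phi -> forall (x v : 'cV[R]_m) (t : R),
  is_derive t 1 (fun s : R => dot (grad phi (x + s *: v)) v)
    (dot v (hess phi (x + t *: v) *m v)).
Proof.
move=> [_ grad_d] x v t; rewrite dotC -derive_grad_hess //.
exact/is_derive_dotl/is_derive_line.
Qed.

(** Two uses of the mean value theorem: on [h1] it gives [h1 t >= h1 0 + a t] for [t > 0], so [h]
    minus its quadratic minorant has a nonnegative derivative on (0, 1), and the second use compares
    its values at 0 and 1. *)
Lemma taylor2_ge (R : realType) (h h1 h2 : R -> R) (a : R) :
  (forall t : R, is_derive t 1 h (h1 t)) ->
  (forall t : R, is_derive t 1 h1 (h2 t)) ->
  (forall t, a <= h2 t) -> h 0 + h1 0 + a / 2 <= h 1.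
Proof.
move=> dh dh1 h2_ge.
have h1_ge t : 0 < t -> h1 0 + a * t <= h1 t.
  move=> t_gt0.
  have [|c _] := MVT t_gt0 (fun s _ => dh1 s).
    by apply: derivable_within_continuous => s _; exact: ex_derive.
  by have := h2_ge c; nra.
pose k : R -> R := h - (h1 0 \*: id + a / 2 \*: (id * id)).
have kE t : k t = h t - (h1 0 * t + a / 2 * (t * t)) by [].
have dk (t : R) : is_derive t 1 k (h1 t - h1 0 - a * t).
  by apply: is_derive_eq; rewrite /GRing.scale /=; lra.
have [|c] := MVT (ltr01 : 0 < 1 :> R) (fun s _ => dk s).
  by apply: derivable_within_continuous => s _; exact: ex_derive.
rewrite in_itv /= => /andP[/h1_ge h1c _].
rewrite !kE; lra.
Qed.

Lemma taylor2_le (R : realType) (h h1 h2 : R -> R) (b : R) :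
  (forall t : R, is_derive t 1 h (h1 t)) ->
  (forall t : R, is_derive t 1 h1 (h2 t)) ->
  (forall t, h2 t <= b) -> h 1 <= h 0 + h1 0 + b / 2.
Proof.
move=> dh dh1 h2_le.
have h2'_ge t : - b <= (- h2) t by rewrite fctE lerN2.
have := taylor2_ge (fun t => is_deriveN (dh t)) (fun t => is_deriveN (dh1 t))
  h2'_ge.
rewrite !fctE; lra.
Qed.

Lemma hess_taylor_ge (R : realType) (m : nat) (phi : 'cV[R]_m -> R) (a : R)
    (x z : 'cV[R]_m) :
  twice_differentiable phi -> (forall w, loewner_le a%:M (hess phi w)) ->
  phi x + dot (grad phi x) (z - x) + a / 2 * dot (z - x) (z - x) <= phi z.
Proof.
move=> phi_diff hess_ge; set v := z - x.
have := taylor2_ge (line_derive1 phi_diff x v) (line_derive2 phi_diff x v).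
move=> /(_ (a * dot v v)) /=.
rewrite scale0r scale1r addr0 subrKC => taylor.
rewrite mulrAC; apply: taylor => t.
have [_ /(_ v)] := hess_ge (x + t *: v).
by rewrite mulmxBl mul_scalar_mx !dotlin subr_ge0.
Qed.

Lemma hess_taylor_le (R : realType) (m : nat) (phi : 'cV[R]_m -> R) (b : R)
    (x z : 'cV[R]_m) :
  twice_differentiable phi -> (forall w, loewner_le (hess phi w) b%:M) ->
  phi z <= phi x + dot (grad phi x) (z - x) + b / 2 * dot (z - x) (z - x).
Proof.
move=> phi_diff hess_le; set v := z - x.
have := taylor2_le (line_derive1 phi_diff x v) (line_derive2 phi_diff x v).
move=> /(_ (b * dot v v)) /=.
rewrite scale0r scale1r addr0 subrKC => taylor.
rewrite [_ / 2 * _]mulrAC; apply: taylor => t.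
have [_ /(_ v)] := hess_le (x + t *: v).
by rewrite mulmxBl mul_scalar_mx !dotlin subr_ge0.
Qed.

(** * The smoothing term and quadratic bounds for the objective *)

Lemma DmxE (R : realType) (m : nat) (mu : R) (x v : 'cV[R]_m) (i : 'I_m) :
  (Dmx mu x *m v) i 0 = (Num.sqrt (mu ^+ 2 + x i 0 ^+ 2))^-1 * v i 0.
Proof. by rewrite /Dmx mul_diag_mx !mxE. Qed.

Lemma pseudo_abs_gt0 (R : realType) (mu a : R) :
  0 < mu -> 0 < Num.sqrt (mu ^+ 2 + a ^+ 2).
Proof. by move=> mu_gt0; rewrite sqrtr_gt0 ltr_wpDr ?sqr_ge0 ?exprn_gt0. Qed.

Lemma pseudo_abs_sqr (R : realType) (mu a : R) :
  Num.sqrt (mu ^+ 2 + a ^+ 2) ^+ 2 = mu ^+ 2 + a ^+ 2.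
Proof. by rewrite sqr_sqrtr // addr_ge0 ?sqr_ge0. Qed.

Lemma pseudo_abs_ge (R : realType) (mu a : R) :
  0 < mu -> mu <= Num.sqrt (mu ^+ 2 + a ^+ 2).
Proof.
move=> mu_gt0.
rewrite -(@ler_pXn2r _ 2) ?nnegrE ?(ltW mu_gt0) ?sqrtr_ge0 //.
by rewrite pseudo_abs_sqr lerDl sqr_ge0.
Qed.

(* With A, B the square roots at a, b, the gap A (B - A - a (b - a) / A) equals
   A B - (mu^2 + a b), which lies between 0 (Cauchy-Schwarz) and
   (b - a)^2 / 2 (AM-GM). *)
Lemma pseudo_abs_taylor (R : realType) (mu a b : R) :
  let A := Num.sqrt (mu ^+ 2 + a ^+ 2) in
  let B := Num.sqrt (mu ^+ 2 + b ^+ 2) in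
  0 < mu ->
  A + A^-1 * a * (b - a) <= B <=
  A + A^-1 * a * (b - a) + mu^-1 / 2 * ((b - a) * (b - a)).
Proof.
move=> A B mu_gt0.
have A_gt0 : 0 < A by exact: pseudo_abs_gt0.
have B_gt0 : 0 < B by exact: pseudo_abs_gt0.
have A2 : A ^+ 2 = mu ^+ 2 + a ^+ 2 by exact: pseudo_abs_sqr.
have B2 : B ^+ 2 = mu ^+ 2 + b ^+ 2 by exact: pseudo_abs_sqr.
have muA : mu <= A by exact: pseudo_abs_ge.
have cs : mu ^+ 2 + a * b <= A * B.
  have [s|s] := leP (mu ^+ 2 + a * b) 0.
    by apply: le_trans s _; rewrite mulr_ge0 // ltW.
  rewrite -(@ler_pXn2r _ 2) ?nnegrE ?(ltW s) //; last first.
    by rewrite mulr_ge0 // ltW.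
  rewrite exprMn A2 B2 -subr_ge0.
  have -> : (mu ^+ 2 + a ^+ 2) * (mu ^+ 2 + b ^+ 2) - (mu ^+ 2 + a * b) ^+ 2 =
    (mu * (a - b)) ^+ 2 by ring.
  exact: sqr_ge0.
have gapE : A * B - (mu ^+ 2 + a * b) = A * (B - (A + A^-1 * a * (b - a))).
  rewrite -[mu ^+ 2](addrK (a ^+ 2)) -A2; field; exact: lt0r_neq0.
have amgm : A * B - (mu ^+ 2 + a * b) <= (b - a) * (b - a) / 2.
  by have := sqr_ge0 (A - B); nra.
apply/andP; split.
  by rewrite -subr_ge0 -(pmulr_rge0 _ A_gt0) -gapE subr_ge0.
rewrite -lerBlDl -(ler_pM2l A_gt0) -gapE; apply: le_trans amgm _.
have -> : A * (mu^-1 / 2 * ((b - a) * (b - a))) =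
  A / mu * ((b - a) * (b - a) / 2) by ring.
rewrite ler_peMl ?(ler_pdivlMr _ _ mu_gt0) ?mul1r //.
by rewrite divr_ge0 // -expr2 sqr_ge0.
Qed.

Lemma psi_taylor_ge (R : realType) (m : nat) (mu : R) (x z : 'cV[R]_m) :
  0 < mu ->
  psi mu x + dot (Dmx mu x *m x) (z - x) <= psi mu z.
Proof.
move=> mu_gt0; rewrite /psi dotE -big_split /=; apply: ler_sum => i _.
rewrite DmxE !mxE.
have /andP[+ _] := pseudo_abs_taylor (x i 0) (z i 0) mu_gt0; lra.
Qed.

Lemma psi_taylor_le (R : realType) (m : nat) (mu : R) (x z : 'cV[R]_m) :
  0 < mu ->
  psi mu z <= psi mu x + dot (Dmx mu x *m x) (z - x) +
              mu^-1 / 2 * dot (z - x) (z - x).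
Proof.
move=> mu_gt0; rewrite /psi !dotE mulr_sumr -!big_split /=.
apply: ler_sum => i _.
rewrite DmxE !mxE.
have /andP[_] := pseudo_abs_taylor (x i 0) (z i 0) mu_gt0; lra.
Qed.

(** Converse of [is_derive_line], asking only for a derivative along one line: directional
    derivatives of [psi] become one-variable computations at 0. *)
Lemma is_derive_of_line (R : realType) (V W : normedModType R) (f : V -> W)
    (x v : V) (l : W) :
  is_derive (0 : R) 1 (fun s : R => f (x + s *: v)) l -> is_derive x v f l.
Proof.
move=> [].
rewrite /derivable /derive /= line_quotientE scale0r addr0 => df fl.
by split.
Qed.

Lemma is_derive_psi (R : realType) (m : nat) (mu : R) (x v : 'cV[R]_m) :
  0 < mu -> is_derive x v (psi mu) (dot (Dmx mu x *m x) v).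
Proof.
move=> mu_gt0; apply: is_derive_of_line.
have -> : (fun s : R => psi mu (x + s *: v)) =
  \sum_i (fun s : R =>
    Num.sqrt (mu ^+ 2 + (x i 0 + s * v i 0) ^+ 2) - mu).
  apply/funext => s; rewrite fct_sumE; apply: eq_bigr => i _.
  by rewrite !mxE.
rewrite dotE; apply: is_derive_sum => i; rewrite DmxE.
(* The radicand of one coordinate along the line; it is positive at 0, where the square root is
   therefore differentiable. *)
pose g : R -> R := cst (mu ^+ 2) + (cst (x i 0) + id * cst (v i 0)) ^+ 2.
have g0 : g 0 = mu ^+ 2 + x i 0 ^+ 2.
  by rewrite /g exprfctE !fctE mul0r addr0.
have dg : is_derive (0 : R) 1 g (2 * x i 0 * v i 0).
  apply: is_derive_eq; rewrite !fctE /GRing.scale /=; ring.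
have dsqrt : is_derive (g 0) 1 (@Num.sqrt R) (2 * Num.sqrt (g 0))^-1.
  by apply: is_derive1_sqrt; rewrite g0 ltr_wpDr ?sqr_ge0 ?exprn_gt0.
have := is_deriveB (is_derive1_comp dsqrt dg) (is_derive_cst mu (0:R) (1:R)).
rewrite g0.
have -> : (fun s : R => Num.sqrt (mu ^+ 2 + (x i 0 + s * v i 0) ^+ 2) - mu) =
  (@Num.sqrt R \o g) - cst mu by [].
move=> h; apply: is_derive_eq; field.
exact/lt0r_neq0/pseudo_abs_gt0.
Qed.

Lemma grad_objective (R : realType) (m : nat) (tau mu : R)
    (phi : 'cV[R]_m -> R) (x : 'cV[R]_m) :
  0 < mu -> differentiable phi x ->
  grad (objective tau mu phi) x = tau *: (Dmx mu x *m x) + grad phi x.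
Proof.
move=> mu_gt0 phi_x; apply/matrixP => i j; rewrite ord1 !mxE.
have e_i := diff_derivable (v := delta_mx i 0) phi_x.
have psi_x := is_derive_psi x (delta_mx i 0) mu_gt0.
have -> : objective tau mu phi = tau \*: psi mu + phi by [].
rewrite (derive_val
  (is_derive := is_deriveD (is_deriveZ tau psi_x) (derivableP e_i))).
congr (tau * _ + _).
rewrite dotC dotE (bigD1 i) //= big1 ?addr0 ?mxE ?eqxx ?mul1r //.
by move=> k ki; rewrite mxE (negbTE ki) mul0r.
Qed.

Lemma objective_ge (R : realType) (m : nat) (tau mu a : R)
    (phi : 'cV[R]_m -> R) (x z : 'cV[R]_m) :
  0 < tau -> 0 < mu -> twice_differentiable phi ->
  (forall w, loewner_le a%:M (hess phi w)) ->
  objective tau mu phi x + dot (grad (objective tau mu phi) x) (z - x) +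
    a / 2 * dot (z - x) (z - x) <= objective tau mu phi z.
Proof.
move=> tau_gt0 mu_gt0 phi_diff hess_ge.
rewrite (grad_objective _ mu_gt0 (phi_diff.1 x)) [dot (_ + grad _ _) _]dotDl.
rewrite dotZl /objective.
have := hess_taylor_ge x z phi_diff hess_ge.
have := psi_taylor_ge x z mu_gt0; nra.
Qed.

(** The second derivative [mu^2 / (mu^2 + t^2)^(3/2)] of each summand of [psi] is at most [1 / mu],
    whence the extra curvature [tau / mu]. *)
Lemma objective_le (R : realType) (m : nat) (tau mu b : R)
    (phi : 'cV[R]_m -> R) (x z : 'cV[R]_m) :
  0 < tau -> 0 < mu -> twice_differentiable phi ->
  (forall w, loewner_le (hess phi w) b%:M) ->
  objective tau mu phi z <=
  objective tau mu phi x + dot (grad (objective tau mu phi) x) (z - x) +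
    (tau / mu + b) / 2 * dot (z - x) (z - x).
Proof.
move=> tau_gt0 mu_gt0 phi_diff hess_le.
rewrite (grad_objective _ mu_gt0 (phi_diff.1 x)) [dot (_ + grad _ _) _]dotDl.
rewrite dotZl /objective.
have := hess_taylor_le x z phi_diff hess_le.
have := psi_taylor_le x z mu_gt0.
rewrite -(ler_pM2l tau_gt0) mulrDr mulrDr; lra.
Qed.

(** * Spectral bounds for the matrix H(x, y) *)

Lemma abs_coord_le_mx_norm (R : realType) (m : nat) (v : 'cV[R]_m)
    (i : 'I_m) : `|v i 0| <= `|v|.
Proof.
rewrite -[leRHS]/(mx_norm v) mx_normrE.
exact: (le_bigmax _ (fun ij : 'I_m * 'I_1 => `|v ij.1 ij.2|) (i, 0)).
Qed.

Lemma BmxE (R : realType) (m : nat) (mu : R) (x y : 'cV[R]_m) :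
  Bmx mu x y = diag_mx (\row_i
    let s := Num.sqrt (mu ^+ 2 + x i 0 ^+ 2) in
    s^-1 * (1 - s^-1 * x i 0 * y i 0)).
Proof.
rewrite /Bmx /Dmx !mulmx_diag -diag_const_mx -linearB mulmx_diag.
by congr diag_mx; apply/matrixP => k i; rewrite !mxE.
Qed.

(** The matrix is diagonal with entries [s^-1 (1 - q)], where [s >= mu], and [|q| <= 1] because
    [|x_i| <= s] and [|y_i| <= 1]. *)
Lemma dot_Bmx_bounds (R : realType) (m : nat) (mu : R) (x y v : 'cV[R]_m) :
  0 < mu -> `|y| <= 1 ->
  0 <= dot v (Bmx mu x y *m v) <= 2 / mu * dot v v.
Proof.
move=> mu_gt0 y_le1; rewrite BmxE !dotE mulr_sumr.
set d := \row_i _.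
have d_bounds i : 0 <= d 0 i <= 2 / mu.
  rewrite mxE /=; set s := Num.sqrt _.
  have s_gt0 : 0 < s by exact: pseudo_abs_gt0.
  have s_ge : mu <= s by exact: pseudo_abs_ge.
  have xs : `|s^-1 * x i 0| <= 1.
    rewrite normrM (gtr0_norm (_ : 0 < s^-1)) ?invr_gt0 //.
    rewrite ler_pdivrMl // mulr1 -sqrtr_sqr ler_sqrt ?addr_ge0 ?sqr_ge0 //.
    by rewrite lerDr sqr_ge0.
  have : `|s^-1 * x i 0 * y i 0| <= 1.
    rewrite normrM mulr_ile1 //.
    exact: le_trans (abs_coord_le_mx_norm y i) y_le1.
  rewrite ler_norml => /andP[q_ge q_le].
  have s_inv : s^-1 <= mu^-1 by rewrite lef_pV2.
  have s_inv_gt0 : 0 < s^-1 by rewrite invr_gt0.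
  apply/andP; split; first by rewrite mulr_ge0 ?(ltW s_inv_gt0) // subr_ge0.
  rewrite mulrC; apply: ler_pM; rewrite ?(ltW s_inv_gt0) ?subr_ge0 //; lra.
have termE i : v i 0 * (diag_mx d *m v) i 0 = d 0 i * v i 0 ^+ 2.
  by rewrite mul_diag_mx mxE; ring.
apply/andP; split.
  apply: sumr_ge0 => i _; rewrite termE mulr_ge0 ?sqr_ge0 //.
  by have /andP[] := d_bounds i.
apply: ler_sum => i _; rewrite termE -expr2 ler_wpM2r ?sqr_ge0 //.
by have /andP[] := d_bounds i.
Qed.

(** Symmetry is part of the Loewner order and a scalar matrix is symmetric; this is the source of
    the symmetry of the Hessian. *)
Lemma loewner_ge_sym (R : realType) (m : nat) (a : R) (A : 'M[R]_m) :
  loewner_le a%:M A -> A^T = A.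
Proof. by case; rewrite linearB /= tr_scalar_mx => /addIr. Qed.

Lemma Hmx_sym (R : realType) (m : nat) (tau mu a : R) (phi : 'cV[R]_m -> R)
    (x y : 'cV[R]_m) :
  loewner_le a%:M (hess phi x) ->
  (Hmx tau mu phi x y)^T = Hmx tau mu phi x y.
Proof.
move=> /loewner_ge_sym hess_sym.
by rewrite /Hmx linearD linearZ /= hess_sym BmxE tr_diag_mx.
Qed.

Lemma dot_Hmx_ge (R : realType) (m : nat) (tau mu a : R)
    (phi : 'cV[R]_m -> R) (x y v : 'cV[R]_m) :
  0 < tau -> 0 < mu -> `|y| <= 1 -> loewner_le a%:M (hess phi x) ->
  a * dot v v <= dot v (Hmx tau mu phi x y *m v).
Proof.
move=> tau_gt0 mu_gt0 y_le1 [_ /(_ v)].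
have /andP[B_ge _] := dot_Bmx_bounds x v mu_gt0 y_le1.
rewrite /Hmx !(mulmxBl, mulmxDl) mul_scalar_mx -scalemxAl !dotlin; nra.
Qed.

Lemma dot_Hmx_le (R : realType) (m : nat) (tau mu b : R)
    (phi : 'cV[R]_m -> R) (x y v : 'cV[R]_m) :
  0 < tau -> 0 < mu -> `|y| <= 1 -> loewner_le (hess phi x) b%:M ->
  dot v (Hmx tau mu phi x y *m v) <= (2 * tau / mu + b) * dot v v.
Proof.
move=> tau_gt0 mu_gt0 y_le1 [_ /(_ v)].
have /andP[_] := dot_Bmx_bounds x v mu_gt0 y_le1.
rewrite -(ler_pM2l tau_gt0).
rewrite /Hmx !(mulmxBl, mulmxDl) mul_scalar_mx -scalemxAl !dotlin; lra.
Qed.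

(* Expand the form at [v - b^-1 H v], where it is nonnegative. *)
Lemma dot_mulmx_sqr_le (R : realType) (m : nat) (H : 'M[R]_m) (b : R)
    (v : 'cV[R]_m) :
  0 < b -> psdmx H -> loewner_le H b%:M ->
  dot (H *m v) (H *m v) <= b * dot v (H *m v).
Proof.
move=> b_gt0 [H_sym H_ge] [_ /(_ (H *m v))].
rewrite mulmxBl mul_scalar_mx !dotlin => H_le.
have := H_ge (b *: v - H *m v).
rewrite mulmxBr -scalemxAr !dotlin [dot v (H *m (H *m v))]dot_trmx H_sym; nra.
Qed.

(** * The truncated CG direction and the line search *)

Lemma cg_direction_galerkin (R : realType) (m : nat) (eta : R) (H : 'M[R]_m)
    (g d : 'cV[R]_m) :
  H^T = H -> (forall v, dot v (H *m v) = 0 -> v = 0) ->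
  cg_direction eta H g d -> dot g d = - dot d (H *m d).
Proof.
move=> H_sym H_def [i _ ->].
have := cg_galerkin (- g) i H_sym H_def.
rewrite !dotlin => /eqP; rewrite -opprD oppr_eq0 addr_eq0 => /eqP <-.
exact: dotC.
Qed.

(** Reverse triangle inequality: [H d] is the residual minus [g], and the residual is at most [eta]
    times as long as [g]. *)
Lemma cg_direction_residual (R : realType) (m : nat) (eta : R) (H : 'M[R]_m)
    (g d : 'cV[R]_m) :
  0 <= eta -> eta < 1 -> cg_direction eta H g d ->
  (1 - eta) ^+ 2 * dot g g <= dot (H *m d) (H *m d).
Proof.
move=> eta_ge0 eta_lt1 [i [res _] d_i]; rewrite -d_i in res.
set r := H *m d + g in res.
have -> : H *m d = r - g by rewrite addrK.
move: r res => r res.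
have := dot_le_enorm r g; have := enorm_ge0 r; have := enorm_ge0 g.
rewrite !dotlin (dotC g r) -!enorm_sqr.
move: (enorm r) (enorm g) res => s t res t_ge0 s_ge0 cs.
have eta_t : 0 <= (1 - eta) * t by rewrite mulr_ge0 // subr_ge0 ltW.
have : ((1 - eta) * t) ^+ 2 <= (t - s) ^+ 2.
  by rewrite ler_pXn2r ?nnegrE //; lra.
rewrite exprMn sqrrB; lra.
Qed.

(* As g.d = - d.Hd, the quadratic upper bound makes every step length up to
   [a / M] acceptable. *)
Lemma backtracking_step_ge (R : realType) (m : nat) (a M c2 c3 : R)
    (f : 'cV[R]_m -> R) (H : 'M[R]_m) (x g d : 'cV[R]_m) (j : nat) :
  0 < a -> a <= M -> c2 < 1 / 2 -> 0 < c3 -> c3 < 1 ->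
  (forall z, f z <= f x + dot g (z - x) + M / 2 * dot (z - x) (z - x)) ->
  a * dot d d <= dot d (H *m d) -> dot g d = - dot d (H *m d) ->
  backtracking c2 c3 f H x d j -> c3 * (a / M) <= c3 ^+ j.
Proof.
move=> a_gt0 a_le c2_lt c3_gt0 c3_lt1 f_le d_ge gd [_ j_least].
have M_gt0 : 0 < M by exact: lt_le_trans a_le.
have aM : a / M <= 1 by rewrite ler_pdivrMr // mul1r.
have aM_ge0 : 0 <= a / M by rewrite divr_ge0 // ltW.
case: j j_least => [|j] j_least; first by rewrite expr0; nra.
(* [c3 ^+ j] is the last rejected trial step. Were it below [a / M], it would pass the test, against
   the leastness of [j.+1]. *)
rewrite exprS ler_pM2l // leNgt; apply/negP => t_lt.
suff : (j.+1 <= j)%N by rewrite ltnn.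
apply: j_least => /=.
have t_gt0 : 0 < c3 ^+ j by exact: exprn_gt0.
move: (c3 ^+ j) t_lt t_gt0 => t t_lt t_gt0.
apply: le_trans (f_le _) _.
have dHd_ge0 : 0 <= dot d (H *m d).
  by apply: le_trans d_ge; rewrite mulr_ge0 ?dotvv_ge0 // ltW.
have -> : x + t *: d - x = t *: d by rewrite addrAC subrr add0r.
rewrite /local_norm sqr_sqrtr // !dotlin gd.
rewrite ltr_pdivlMr // in t_lt.
(* The quadratic term costs at most half of the linear gain [t d.Hd]; the other half exceeds the
   required [c2 t d.Hd] since [c2 < 1 / 2]. *)
have : t * (t * M * dot d d) <= t * dot d (H *m d).
  rewrite ler_pM2l //; apply: le_trans d_ge.
  by rewrite ler_wpM2r ?dotvv_ge0 // ltW.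
have : 0 <= t * dot d (H *m d) * (1 / 2 - c2).
  by rewrite !mulr_ge0 ?(ltW t_gt0) // subr_ge0 ltW.
lra.
Qed.

(** * Convergence of descent sequences for strongly convex functions *)

Lemma cvg_dot (R : realType) (m : nat) (u v : nat -> 'cV[R]_m)
    (u0 v0 : 'cV[R]_m) :
  u @ \oo --> u0 -> v @ \oo --> v0 ->
  (fun k => dot (u k) (v k)) @ \oo --> dot u0 v0.
Proof.
move=> u_cvg v_cvg.
have coord (w : nat -> 'cV[R]_m) (w0 : 'cV[R]_m) i : w @ \oo --> w0 ->
    (fun k => w k i 0) @ \oo --> w0 i 0.
  move=> w_cvg; apply: (cvg_comp w (fun z => z i 0) w_cvg).
  exact: (@coord_continuous _ _ _ i 0 w0).
rewrite dotE; under eq_fun do rewrite dotE.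
apply: cvg_big => [|i _]; first exact: add_continuous.
by apply: cvgM; apply: coord.
Qed.

Lemma cvg_enorm0 (R : realType) (m : nat) (u : nat -> 'cV[R]_m) :
  (fun k => enorm (u k)) @ \oo --> (0 : R) -> u @ \oo --> (0 : 'cV[R]_m).
Proof.
move=> u0; apply/norm_cvg0P.
apply: (squeeze_cvgr _ (cvg_cst 0) u0).
by near=> k; rewrite normr_ge0 mx_norm_le_enorm.
Unshelve. all: by end_near. Qed.

(** The values [f (x k)] decrease and are bounded below, so their successive differences, which
    dominate [c |g (x k)|^2], tend to 0. *)
Lemma descent_grad_cvg0 (R : realType) (m : nat) (a c : R)
    (f : 'cV[R]_m -> R) (g : 'cV[R]_m -> 'cV[R]_m) (x : nat -> 'cV[R]_m) :
  0 < a -> 0 < c ->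
  (forall u z,
    f u + dot (g u) (z - u) + a / 2 * dot (z - u) (z - u) <= f z) ->
  (forall k, f (x k.+1) <= f (x k) - c * dot (g (x k)) (g (x k))) ->
  (fun k => enorm (g (x k))) @ \oo --> (0 : R).
Proof.
move=> a_gt0 c_gt0 f_ge f_decr.
have f_cvg : cvgn (f \o x).
  apply: nonincreasing_is_cvgn.
    apply/nonincreasing_seqP => k /=; apply: le_trans (f_decr k) _.
    by rewrite gerBl mulr_ge0 ?dotvv_ge0 // ltW.
  (* The minimum over z of the quadratic lower bound of [f] at the origin, found by completing the
     square. *)
  exists (f 0 - (2 * a)^-1 * dot (g 0) (g 0)) => _ [k _ <-] /=.
  apply: le_trans (f_ge 0 (x k)); rewrite subr0.
  have := dotvv_ge0 (g 0 + a *: x k); rewrite !dotlin (dotC (x k)) => sq.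
  have : 0 <= (2 * a)^-1 * (dot (g 0) (g 0) + a * dot (g 0) (x k) +
     (a * dot (g 0) (x k) + a * (a * dot (x k) (x k)))).
    by rewrite mulr_ge0 // ?invr_ge0; nra.
  have -> : (2 * a)^-1 * (dot (g 0) (g 0) + a * dot (g 0) (x k) +
     (a * dot (g 0) (x k) + a * (a * dot (x k) (x k)))) =
    (2 * a)^-1 * dot (g 0) (g 0) + dot (g 0) (x k) + a / 2 * dot (x k) (x k).
    by field; exact: lt0r_neq0.
  lra.
have diff_cvg : (fun k => c^-1 * (f (x k) - f (x k.+1))) @ \oo --> (0 : R).
  rewrite -(mulr0 c^-1) -(subrr (limn (f \o x))).
  apply: cvgM; [exact: cvg_cst | apply: cvgB => //].
  by move: f_cvg; rewrite -cvg_shiftS.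
have gg_cvg : (fun k => dot (g (x k)) (g (x k))) @ \oo --> (0 : R).
  apply: (squeeze_cvgr _ (cvg_cst 0) diff_cvg).
  near=> k; rewrite dotvv_ge0 /= ler_pdivlMl //; have := f_decr k; lra.
rewrite -[X in _ --> X]sqrtr0.
by apply: continuous_cvg gg_cvg; exact: sqrt_continuous.
Unshelve. all: by end_near. Qed.

Lemma descent_cvg (R : realType) (m : nat) (a M c : R)
    (f : 'cV[R]_m -> R) (g : 'cV[R]_m -> 'cV[R]_m) (x : nat -> 'cV[R]_m) :
  0 < a -> 0 < c ->
  (forall u z,
    f u + dot (g u) (z - u) + a / 2 * dot (z - u) (z - u) <= f z) ->
  (forall u z,
    f z <= f u + dot (g u) (z - u) + M / 2 * dot (z - u) (z - u)) ->
  (forall k, f (x k.+1) <= f (x k) - c * dot (g (x k)) (g (x k))) ->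
  exists xs, minimizer f xs /\ x @ \oo --> xs.
Proof.
move=> a_gt0 c_gt0 f_ge f_le f_decr.
have g0 := descent_grad_cvg0 a_gt0 c_gt0 f_ge f_decr.
have dist_le u z : a * enorm (u - z) <= enorm (g u) + enorm (g z).
  (* Strong monotonicity of [g], by adding the lower bounds at [u] and at [z]. Cauchy-Schwarz and
     division by [|u - z|] then give the distance bound. *)
  have mono : a * dot (u - z) (u - z) <=
      dot (g u) (u - z) + dot (- g z) (u - z).
    have := f_ge u z; have := f_ge z u.
    by rewrite -(opprB u z) !dotlin; lra.
  have [uz|] := eqVneq (enorm (u - z)) 0.
    by rewrite uz mulr0 addr_ge0 ?enorm_ge0.
  have := enorm_ge0 (u - z); rewrite le_eqVlt eq_sym => /orP[->//|uz _].
  rewrite -(ler_pM2r uz) -mulrA -expr2 enorm_sqr; apply: le_trans mono _.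
  rewrite mulrDl lerD ?dot_le_enorm //.
  have -> : enorm (g z) = enorm (- g z) by rewrite /enorm !dotlin opprK.
  exact: dot_le_enorm.
have x_cauchy : cauchy (x @ \oo).
  apply: cauchy_exP => e e_gt0.
  have : \forall k \near \oo, enorm (g (x k)) < a * e / 2.
    have ae_gt0 : 0 < a * e / 2 by rewrite divr_gt0 ?mulr_gt0.
    have /cvgr0Pnorm_lt/(_ _ ae_gt0) := g0.
    by apply: filterS => k; exact/le_lt_trans/ler_norm.
  case=> N _ gN; exists (x N).
  exists N => // k Nk; rewrite mx_norm_ball /ball_ /=.
  apply: le_lt_trans (mx_norm_le_enorm _) _.
  rewrite -(ltr_pM2l a_gt0); apply: le_lt_trans (dist_le _ _) _.
  have := gN _ Nk; have := gN N (leqnn N) => /=; lra.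
have /cvg_ex[xs x_cvg] : cvgn x by exact: cauchy_cvg x_cauchy.
exists xs; split=> // z.
(* This sequence bounds [f xs] from above: combine the upper bound of [f] from [x k] to [xs] with
   the lower bound from [x k] to [z]. Its limit is [f z]. *)
have bound_cvg : (fun k => f z + dot (g (x k)) (xs - z) +
    M / 2 * dot (xs - x k) (xs - x k)) @ \oo -->
    f z + dot 0 (xs - z) + M / 2 * dot (0 : 'cV_m) 0.
  have gk : (fun k => dot (g (x k)) (xs - z)) @ \oo --> dot 0 (xs - z).
    by apply: cvg_dot (cvg_enorm0 g0) _; exact: cvg_cst.
  have xs_x : (fun k => xs - x k) @ \oo --> (0 : 'cV[R]_m).
    by rewrite -(subrr xs); apply: cvgB => //; exact: cvg_cst.
  exact: (cvgD (cvgD (cvg_cst (f z)) gk)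
    (cvgM (cvg_cst (M / 2)) (cvg_dot xs_x xs_x))).
rewrite !dot0l mulr0 !addr0 in bound_cvg.
apply: (ler_cvg_to (cvg_cst (f xs)) bound_cvg).
near=> k.
apply: le_trans (f_le (x k) xs) _; rewrite lerD2r.
have := f_ge (x k) z.
have := dotvv_ge0 (z - x k).
have -> : xs - z = (xs - x k) - (z - x k) by rewrite opprB addrA subrK.
rewrite [dot _ (_ - (z - x k))]dotDr [dot _ (- _)]dotNr; nra.
Unshelve. all: by end_near. Qed.

(** At the midpoint w the linear terms towards [x] and [z] cancel, so
    [f x + f z >= 2 f w + (a / 4) |z - x|^2], while neither [f x] nor [f z] exceeds [f w]. *)
Lemma minimizer_unique (R : realType) (m : nat) (a : R)
    (f : 'cV[R]_m -> R) (g : 'cV[R]_m -> 'cV[R]_m) (x z : 'cV[R]_m) :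
  0 < a ->
  (forall u z,
    f u + dot (g u) (z - u) + a / 2 * dot (z - u) (z - u) <= f z) ->
  minimizer f x -> minimizer f z -> z = x.
Proof.
move=> a_gt0 f_ge x_min z_min.
pose w := x + 2^-1 *: (z - x).
have zw : z - w = 2^-1 *: (z - x).
  rewrite /w; apply/matrixP => i j; rewrite !mxE; lra.
have xw : x - w = - (2^-1 *: (z - x)).
  by rewrite /w opprD addrA subrr add0r.
have := f_ge w z; have := f_ge w x; rewrite zw xw !dotNl !dotNr !dotZl !dotZr.
have := x_min w; have := x_min z; have := z_min w => zw_le xz_le xw_le fx fz.
apply/eqP; rewrite -subr_eq0 -dotvv_eq0 eq_le dotvv_ge0 andbT.
rewrite -(pmulr_rle0 _ a_gt0); lra.
Qed.

(** * Decrease per iteration and convergence of pdNCG *)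

Lemma pdNCG_dual_le1 (R : realType) (m : nat) (tau mu eta c2 c3 : R)
    (phi : 'cV[R]_m -> R) (x y : nat -> 'cV[R]_m) (k : nat) :
  pdNCG tau mu eta c2 c3 phi x y -> `|y k| <= 1.
Proof.
by case: k => [|k] [y0 step] //; have [d [j [_ [] ]]] := step k.
Qed.

(** The constant is [c2], times the least accepted step length, times the ratio between [d.Hd] and
    [|g|^2]. Two curvature bounds enter: [tau / mu + b] for the objective and [2 * tau / mu + b] for
    H, whose diagonal part depends on [y]. *)
Lemma pdNCG_step_decrease (R : realType) (m : nat) (tau mu : R)
    (phi : 'cV[R]_m -> R) (a b eta c2 c3 : R)
    (x y d x' y' : 'cV[R]_m) (j : nat) :
  0 < tau -> 0 < mu -> twice_differentiable phi -> 0 < a -> a <= b ->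
  (forall w, loewner_le a%:M (hess phi w)) ->
  (forall w, loewner_le (hess phi w) b%:M) ->
  0 < c2 -> c2 < 1 / 2 -> 0 < c3 -> c3 < 1 -> 0 <= eta -> eta < 1 ->
  `|y| <= 1 -> pdNCG_step tau mu eta c2 c3 phi x y d j x' y' ->
  objective tau mu phi x' <= objective tau mu phi x -
    c2 * (c3 * (a / (tau / mu + b))) *
    ((1 - eta) ^+ 2 / (2 * tau / mu + b)) *
    dot (grad (objective tau mu phi) x) (grad (objective tau mu phi) x).
Proof.
move=> tau_gt0 mu_gt0 phi_diff a_gt0 ab hess_ge hess_le c2_gt0 c2_lt c3_gt0.
move=> c3_lt1 eta_ge0 eta_lt1 y_le1 [cg_d _ ls ->].
set f := objective tau mu phi in cg_d ls *.
set H := Hmx tau mu phi x y in cg_d ls.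
have tm_gt0 : 0 < tau / mu by exact: divr_gt0.
have H_ge v : a * dot v v <= dot v (H *m v) by exact: dot_Hmx_ge.
have H_sym : H^T = H by exact: Hmx_sym (hess_ge x).
have H_ge0 v : 0 <= dot v (H *m v).
  by apply: le_trans (H_ge v); rewrite mulr_ge0 ?dotvv_ge0 // ltW.
have H_def v : dot v (H *m v) = 0 -> v = 0.
  move=> vHv; apply/eqP; rewrite -dotvv_eq0 eq_le dotvv_ge0 andbT.
  by rewrite -(pmulr_rle0 _ a_gt0) -vHv.
set Lam := 2 * tau / mu + b.
have Lam_gt0 : 0 < Lam by rewrite /Lam -mulrA; lra.
have H_le : loewner_le H Lam%:M.
  split; first by rewrite linearB /= tr_scalar_mx H_sym.
  move=> v; rewrite mulmxBl mul_scalar_mx !dotlin subr_ge0.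
  exact: dot_Hmx_le.
have t_ge : c3 * (a / (tau / mu + b)) <= c3 ^+ j.
  apply: (backtracking_step_ge _ _ c2_lt _ _ _ (H_ge d) _ ls) => //; first lra.
    by move=> z; exact: objective_le.
  exact: cg_direction_galerkin cg_d.
(* Chain [(1 - eta)^2 |g|^2 <= |H d|^2 <= Lam d.Hd]. *)
have dHd_ge : (1 - eta) ^+ 2 / Lam * dot (grad f x) (grad f x) <=
    dot d (H *m d).
  rewrite mulrAC ler_pdivrMr // mulrC [leRHS]mulrC.
  rewrite mulrC; apply: le_trans (cg_direction_residual _ _ cg_d) _ => //.
  exact: dot_mulmx_sqr_le.
case: ls => ls _; apply: le_trans ls _; rewrite lerD2l lerN2.
rewrite /local_norm sqr_sqrtr // -[leLHS]mulrA.
apply: ler_pM => //; last by rewrite ler_pM2l.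
- rewrite !mulr_ge0 ?invr_ge0 ?(ltW a_gt0) ?(ltW c2_gt0) ?(ltW c3_gt0) //.
  lra.
- by rewrite mulr_ge0 ?dotvv_ge0 ?divr_ge0 ?sqr_ge0 // ltW.
Qed.

Unset Implicit Arguments.

Theorem theorem1 (R : realType) (m : nat)
  (tau mu : R) (tau_gt0 : 0 < tau) (mu_gt0 : 0 < mu)
  (phi : 'cV[R]_m -> R) (phi_diff : twice_differentiable phi)
  (lam1 lamm : R) (lamm_gt0 : 0 < lamm) (lamm_le : lamm <= lam1)
  (hess_ge : forall x, loewner_le lamm%:M (hess phi x))
  (hess_le : forall x, loewner_le (hess phi x) lam1%:M)
  (L : R) (L_ge0 : 0 <= L)
  (hess_lip : forall x y,
     spectral_norm (hess phi y - hess phi x) <= L * enorm (y - x))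
  (c2 c3 : R) (c2_gt0 : 0 < c2) (c2_lt : c2 < 1 / 2)
  (c3_gt0 : 0 < c3) (c3_lt1 : c3 < 1)
  (eta : R) (eta_ge0 : 0 <= eta) (eta_lt1 : eta < 1)
  (x y : nat -> 'cV[R]_m) (xy_pdNCG : pdNCG tau mu eta c2 c3 phi x y) :
  exists xs : 'cV[R]_m,
    [/\ minimizer (objective tau mu phi) xs,
        forall z, minimizer (objective tau mu phi) z -> z = xs &
        x @ \oo --> xs].
Proof.
have f_ge u z := objective_ge u z tau_gt0 mu_gt0 phi_diff hess_ge.
have f_le u z := objective_le u z tau_gt0 mu_gt0 phi_diff hess_le.
have tm_gt0 : 0 < tau / mu by exact: divr_gt0.
(* The same decrease constant serves every iteration; it is positive because [eta < 1] and
   [lamm > 0]. *)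
pose c := c2 * (c3 * (lamm / (tau / mu + lam1))) *
  ((1 - eta) ^+ 2 / (2 * tau / mu + lam1)).
have c_gt0 : 0 < c.
  have eta'_gt0 : 0 < 1 - eta by rewrite subr_gt0.
  have lam1_gt0 : 0 < lam1 by exact: lt_le_trans lamm_le.
  have M_gt0 : 0 < tau / mu + lam1 by exact: addr_gt0.
  have Lam_gt0 : 0 < 2 * tau / mu + lam1 by rewrite -mulrA; lra.
  by rewrite /c !(mulr_gt0, invr_gt0, exprn_gt0).
have decr k : objective tau mu phi (x k.+1) <= objective tau mu phi (x k) -
    c * dot (grad (objective tau mu phi) (x k))
            (grad (objective tau mu phi) (x k)).
  have y_le1 := pdNCG_dual_le1 k xy_pdNCG.
  have [_ /(_ k)[d [j step]]] := xy_pdNCG.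
  exact: (pdNCG_step_decrease tau_gt0 mu_gt0 phi_diff lamm_gt0 lamm_le hess_ge
    hess_le c2_gt0 c2_lt c3_gt0 c3_lt1 eta_ge0 eta_lt1 y_le1 step).
have [xs [xs_min x_cvg]] := descent_cvg lamm_gt0 c_gt0 f_ge f_le decr.
exists xs; split=> // z; exact: minimizer_unique lamm_gt0 f_ge xs_min.
Qed.
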